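(* Let $S_p=S_{\tau,\eta,\mu}(P)$ and $S_q=S_{\tau,\eta,0}(Q)$ be the symbolic systems of a plant $P$ and a specification $Q$. Consider the procedure that successively constructs $S_p$, $S_q$, the composition $C^\ast=S_p\parallel_0S_q$ and the non-blocking part $Nb(C^\ast)$. Its space complexity, i.e. the maximal number of transitions of the systems $S_p$, $S_q$, $C^\ast$, $Nb(C^\ast)$ it constructs, is $$O\bigl(\max\{\operatorname{card}([X_p]_{2\eta})\cdot\operatorname{card}([U_p]_{2\mu}),\ \operatorname{card}([X_q]_{2\eta})\}\bigr).$$
   Context: $\|\cdot\|$ is the infinity norm on $\mathbb R^n$. A control system is $\Sigma=(X,X_0,U,\mathcal U,f)$ with $X\subseteq\mathbb R^n$, $X_0\subseteq X$, $U\subseteq\mathbb R^m$, $\mathcal U$ a subset of the locally essentially bounded functions from intervals $]a,b[$ ($a<0<b$) to $U$, and $f:\mathbb R^n\times U\to\mathbb R^n$ continuous and Lipschitz in $x$ on compact sets uniformly in $u\in U$. A trajectory is a curve $\xi$ with $\dot\xi=f(\xi,u)$ a.e.; $\xi_{xu}(\tau)$ is the point reached at time $\tau$ from $x$ under $u$. Forward complete: every trajectory is defined on an interval $]a,\infty[$. $\Sigma$ is $\delta$-ISS if it is forward complete and $\|\xi_{xu}(t)-\xi_{x'u'}(t)\|\le\beta(\|x-x'\|,t)+\gamma(\|u-u'\|_\infty)$ for all $t\ge0$, $x,x'\in\mathbb R^n$, $u,u'\in\mathcal U$, for some continuous $\gamma$ strictly increasing, unbounded with $\gamma(0)=0$ ($\mathcal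 K_\infty$) and some continuous $\beta$ with $\beta(\cdot,s)\in\mathcal K_\infty$ and $\beta(r,\cdot)$ decreasing to $0$ ($\mathcal{KL}$). Setting. $P=(X_p,X_{p,0},U_p,\mathcal U_p,f_p)$ is a control system; $Q=(X_q,X_{q,0},U_q,\mathcal U_q,f_q)$ is an autonomous system $\dot x=g_q(x)$, viewed as a control system with $U_q=\{0\}$ and only the null input. $X_p$, $U_p$, $X_q$ are bounded. $P$ and $Q$ are $\delta$-ISS with functions $\beta_p,\gamma_p$ and $\beta_q$. Given $\varepsilon>0$, parameters $\theta_p,\theta_q,\tau,\eta,\mu>0$ satisfy $\theta_p+\theta_q\le\varepsilon$, $\beta_p(\theta_p,\tau)+\gamma_p(\mu)+\eta\le\theta_p$, $\beta_q(\theta_q,\tau)+\eta\le\theta_q$. A system is $S=(X,X_0,U,\to,Y,H)$ with states $X$, initial states $X_0\subseteq X$, inputs $U$, transitions $\to\subseteq X\times U\times X$, output set $Y$, output map $H:X\to Y$; non-blocking if every state has an outgoing transition. $S_1\sqsubseteq S_2$ (sub-system) if all of $X_1,X_{0,1},U_1,\to_1,Y_1$ are contained in the corresponding sets of $S_2$ and $H_1=H_2$ on $X_1$. $Nb(S)$ is the non-blocking sub-system of $S$ such that $S'\sqsubseteq Nb(S)$ for every non-blocking $S'\sqsubseteq S$. $S_1\parallel_0S_2$ has states $\{(x_1,x_2):H_1(x_1)=H_2(x_2)\}$, initial states those with $x_i\in X_{0,i}$, inputs $U_1\times U_2$, transitions $(x_1,x_2)\xrightarrow{(u_1,u_2)}(x_1',x_2')$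 between such states whenever $x_i\xrightarrow{u_i}x_i'$ for $i=1,2$, and output map $(x_1,x_2)\mapsto H_1(x_1)$. All outputs are regarded in $\mathbb R^n$. $[A]_\mu=\{a\in A:a_i=k_i\mu,\ k_i\in\mathbb Z\}$; $\mathcal B_{[\eta[}(y)=\prod_i[y_i-\eta,y_i+\eta[$. $S_{\tau,\eta,\mu}(\Sigma)$ has states $[X]_{2\eta}$, initial states $[X]_{2\eta}\cap X_0$, inputs $[U]_{2\mu}$ (as constant inputs on $[0,\tau]$), transitions $x\xrightarrow{u}y$ iff $\xi_{xu}(\tau)\in\mathcal B_{[\eta[}(y)\cap X$, output map the inclusion; for $Q$, $\mu=0$ means the input set is $\{0\}$. The $O(\cdot)$ is a worst-case bound with absolute implied constant. *)

(* Defs.v *)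
From HB Require Import structures.
From mathcomp Require Import all_boot all_order all_algebra finmap.
From mathcomp Require Import all_classical all_reals all_analysis.
From mathcomp Require Import ess_sup_inf.

Set Implicit Arguments.
Unset Strict Implicit.
Unset Printing Implicit Defensive.

Import Order.TTheory GRing.Theory Num.Theory.
Import numFieldNormedType.Exports.

Local Open Scope classical_set_scope.
Local Open Scope ring_scope.

(* The norm `|x| of x : 'rV[R]_n is the infinity norm. *)

Definition oitv (R : realType) (a b : \bar R) : set R :=
  [set t | (a < t%:E < b)%E].

Definition abs_continuous (R : realType) (n : nat) (c d : R)
    (xi : R -> 'rV[R]_n) : Prop :=
  forall e : R, 0 < e -> exists2 delta : R, 0 < delta &
    forall s : seq (R * R),
      (forall p, p \in s -> c <= p.1 /\ p.1 <= p.2 /\ p.2 <= d) ->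
      pairwise (fun p q => (p.2 <= q.1) || (q.2 <= p.1)) s ->
      \sum_(p <- s) (p.2 - p.1) < delta ->
      \sum_(p <- s) `|xi p.2 - xi p.1| < e.

(* xi is total; only its values on the interval J matter. *)
Definition solution (R : realType) (n m : nat)
    (f : 'rV[R]_n -> 'rV[R]_m -> 'rV[R]_n) (u : R -> 'rV[R]_m) (J : set R)
    (xi : R -> 'rV[R]_n) : Prop :=
  (forall c d : R, `[c, d] `<=` J -> abs_continuous c d xi) /\
  {ae @lebesgue_measure R, forall t, J t -> is_derive t (1 : R) xi (f (xi t) (u t))}.

(* A function on ]ci_lo, ci_hi[, totalised with irrelevant values outside. *)
Record control_input (R : realType) (m : nat) := ControlInput {
  ci_lo : \bar R;
  ci_hi : \bar R;
  ci_fun :> R -> 'rV[R]_m;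
  ci_lo_lt0 : (ci_lo < 0)%E;
  ci_hi_gt0 : (0 < ci_hi)%E }.

Definition ci_dom (R : realType) (m : nat) (u : control_input R m) : set R :=
  oitv (ci_lo u) (ci_hi u).

(* Lebesgue measurability is agreement a.e. with a Borel function, as the
   sigma-algebra on R is the Borel one. *)
Definition loc_ess_bounded (R : realType) (m : nat) (U : set 'rV[R]_m)
    (u : control_input R m) : Prop :=
  [/\ forall t, ci_dom u t -> U (u t),
      forall i : 'I_m, exists2 v : R -> R, measurable_fun (ci_dom u) v &
        {ae @lebesgue_measure R, forall t, ci_dom u t -> u t 0 i = v t}
    & forall c d : R, `[c, d] `<=` ci_dom u -> exists M : R,
        {ae @lebesgue_measure R, forall t, c <= t <= d -> `|u t| <= M}].

Record control_system (R : realType) (n m : nat) := ControlSystem {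
  cs_state : set 'rV[R]_n;
  cs_init : set 'rV[R]_n;
  cs_input : set 'rV[R]_m;
  cs_curves : set (control_input R m);
  cs_field : 'rV[R]_n -> 'rV[R]_m -> 'rV[R]_n;
  cs_init_sub : cs_init `<=` cs_state;
  cs_curves_sub : cs_curves `<=` loc_ess_bounded cs_input;
  cs_field_continuous :
    {within [set xu : 'rV[R]_n * 'rV[R]_m | cs_input xu.2],
      continuous (fun xu => cs_field xu.1 xu.2)};
  cs_field_lipschitz : forall K : set 'rV[R]_n, compact K ->
    exists L : R, forall x y u, K x -> K y -> cs_input u ->
      `|cs_field x u - cs_field y u| <= L * `|x - y| }.

Definition trajectory (R : realType) (n m : nat) (Sigma : control_system R n m)
    (u : control_input R m) (a b : \bar R) (xi : R -> 'rV[R]_n) : Prop :=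
  [/\ (a < 0)%E, (0 < b)%E, cs_curves Sigma u, oitv a b `<=` ci_dom u
    & solution (cs_field Sigma) u (oitv a b) xi].

(* A restriction of a trajectory is a trajectory, so what is required is that
   every trajectory extends to infinity under the same input. *)
Definition forward_complete (R : realType) (n m : nat)
    (Sigma : control_system R n m) : Prop :=
  forall u a b xi, trajectory Sigma u a b xi ->
    exists2 xi', trajectory Sigma u a +oo%E xi' &
      forall t, oitv a b t -> xi' t = xi t.

Definition Kinf (R : realType) (g : R -> R) : Prop :=
  [/\ {within `[0, +oo[, continuous g},
      forall x y, 0 <= x -> x < y -> g x < g y,
      g 0 = 0
    & g x @[x --> +oo] --> +oo].

Definition KL (R : realType) (beta : R -> R -> R) : Prop :=
  [/\ {within [set p : R * R | 0 <= p.1 /\ 0 <= p.2],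
        continuous (fun p => beta p.1 p.2)},
      forall s, 0 <= s -> Kinf (fun r => beta r s),
      forall r, 0 <= r ->
        forall s t, 0 <= s -> s <= t -> beta r t <= beta r s
    & forall r, 0 <= r -> beta r s @[s --> +oo] --> (0 : R)].

Definition input_dist (R : realType) (m : nat) (u u' : control_input R m)
    : \bar R :=
  ess_sup (@lebesgue_measure R)
    (fun t : R => (if 0 <= t then `|u t - u' t| else 0)%:E).

(* Under an infinite input distance the inequality is void, as gamma is
   unbounded. *)
Definition delta_ISS (R : realType) (n m : nat) (Sigma : control_system R n m)
    (beta : R -> R -> R) (gamma : R -> R) : Prop :=
  [/\ forward_complete Sigma, KL beta, Kinf gamma
    & forall u u' a a' xi xi',
        trajectory Sigma u a +oo%E xi -> trajectory Sigma u' a' +oo%E xi' ->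
        (input_dist u u' < +oo)%E ->
        forall t : R, 0 <= t ->
          `|xi t - xi' t| <=
            beta `|xi 0 - xi' 0| t + gamma (fine (input_dist u u'))].

(* The system x' = f (x, 0): the only input is the null one, defined on R. *)
Definition autonomous (R : realType) (n m : nat) (Sigma : control_system R n m)
    : Prop :=
  cs_input Sigma = [set 0] /\
  cs_curves Sigma =
    [set u | [/\ ci_lo u = -oo%E, ci_hi u = +oo%E & forall t, u t = 0]].

Record system (X U Y : Type) := System {
  states : set X;
  init : set X;
  inputs : set U;
  trans : set (X * U * X);
  outputs : set Y;
  outmap : X -> Y;
  init_sub : init `<=` states;
  trans_sub : trans `<=` states `*` inputs `*` states;
  outmap_sub : forall x, states x -> outputs (outmap x) }.

Definition nonblocking (X U Y : Type) (S : system X U Y) : Prop :=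
  forall x, states S x -> exists u x', trans S (x, u, x').

Definition subsystem (X U Y : Type) (S1 S2 : system X U Y) : Prop :=
  [/\ states S1 `<=` states S2, init S1 `<=` init S2,
      inputs S1 `<=` inputs S2, trans S1 `<=` trans S2
    & outputs S1 `<=` outputs S2] /\
  (forall x, states S1 x -> outmap S1 x = outmap S2 x).

Definition is_Nb (X U Y : Type) (S N : system X U Y) : Prop :=
  [/\ subsystem N S, nonblocking N
    & forall S', subsystem S' S -> nonblocking S' -> subsystem S' N].

Section Nb.
Context {X U Y : Type} (S : system X U Y).

Let nbsub (S' : system X U Y) := subsystem S' S /\ nonblocking S'.
Let union {T : Type} (F : system X U Y -> set T) : set T :=
  [set x | exists2 S', nbsub S' & F S' x].

Lemma Nb_exists : exists N, is_Nb S N.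
Proof.
have hI : union (@init X U Y) `<=` union (@states X U Y).
  by move=> x [S' h xS']; exists S' => //; exact: init_sub xS'.
have hT : union (@trans X U Y) `<=`
    union (@states X U Y) `*` union (@inputs X U Y) `*` union (@states X U Y).
  by move=> x [S' h xS']; have [[? ?] ?] := trans_sub xS'; do !split; exists S'.
have hO x : union (@states X U Y) x -> union (@outputs X U Y) (outmap S x).
  move=> [S' [[h e] nb] xS']; exists S' => //.
  by rewrite -e//; exact: outmap_sub.
exists (System hI hT hO); split.
- by split=> //; split=> x [S' [[[? ? ? ? ?] _] _]]; auto.
- move=> x [S' [h nb] xS']; have [u [x' t]] := nb x xS'.
  by exists u, x', S'.
- move=> S' h nb; split; last by case: h => _ e x /= /e.
  by split=> x xS'; exists S'.
Qed.

Definition Nb : system X U Y := projT1 (cid Nb_exists).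

Lemma NbP : is_Nb S Nb.
Proof. exact: projT2 (cid Nb_exists). Qed.

End Nb.

Section Composition.
Context {X1 U1 X2 U2 Y : Type}.
Context (S1 : system X1 U1 Y) (S2 : system X2 U2 Y).

Let states0 : set (X1 * X2) :=
  [set x | [/\ states S1 x.1, states S2 x.2 & outmap S1 x.1 = outmap S2 x.2]].
Let init0 : set (X1 * X2) :=
  [set x | [/\ states0 x, init S1 x.1 & init S2 x.2]].
Let trans0 : set ((X1 * X2) * (U1 * U2) * (X1 * X2)) :=
  [set t | [/\ states0 t.1.1, states0 t.2,
    trans S1 (t.1.1.1, t.1.2.1, t.2.1) & trans S2 (t.1.1.2, t.1.2.2, t.2.2)]].

Let init0_sub : init0 `<=` states0. Proof. by move=> x []. Qed.

Let trans0_sub :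
  trans0 `<=` states0 `*` (inputs S1 `*` inputs S2) `*` states0.
Proof.
move=> t [? ? t1 t2].
by have [[_ ?] _] := trans_sub t1; have [[_ ?] _] := trans_sub t2.
Qed.

Let outmap0_sub x : states0 x -> outputs S1 (outmap S1 x.1).
Proof. by move=> [? _ _]; exact: outmap_sub. Qed.

Definition composition : system (X1 * X2) (U1 * U2) Y :=
  System init0_sub trans0_sub outmap0_sub.

End Composition.

Definition grid (R : realType) (n : nat) (A : set 'rV[R]_n) (d : R)
    : set 'rV[R]_n :=
  [set a | A a /\ forall i, exists k : int, a 0 i = k%:~R * d].

Definition box (R : realType) (n : nat) (eta : R) (y : 'rV[R]_n)
    : set 'rV[R]_n :=
  [set z | forall i, y 0 i - eta <= z 0 i < y 0 i + eta].

(* z is the point reached from x at time tau under the constant input u. *)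
Definition reaches (R : realType) (n m : nat) (Sigma : control_system R n m)
    (x : 'rV[R]_n) (u : 'rV[R]_m) (tau : R) (z : 'rV[R]_n) : Prop :=
  exists xi : R -> 'rV[R]_n,
    [/\ solution (cs_field Sigma) (fun=> u) `[0, tau] xi, xi 0 = x
      & xi tau = z].

Section Symbolic.
Context {R : realType} {n m : nat} (tau eta mu : R).
Context (Sigma : control_system R n m).

Let X' := grid (cs_state Sigma) (2 * eta).
Let U' := grid (cs_input Sigma) (2 * mu).
Let T' : set ('rV[R]_n * 'rV[R]_m * 'rV[R]_n) :=
  [set t | [/\ X' t.1.1, U' t.1.2, X' t.2
    & exists z, [/\ reaches Sigma t.1.1 t.1.2 tau z, box eta t.2 z
      & cs_state Sigma z]]].

Let initS : X' `&` cs_init Sigma `<=` X'. Proof. by move=> x []. Qed.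
Let transS : T' `<=` X' `*` U' `*` X'. Proof. by move=> t []. Qed.
Let outS x : X' x -> [set: 'rV[R]_n] (id x). Proof. by []. Qed.

Definition symbolic : system 'rV[R]_n 'rV[R]_m 'rV[R]_n :=
  System initS transS outS.

End Symbolic.

(* The cardinality of a finite set (and 0 for an infinite one). *)
Definition ncard (T : choiceType) (A : set T) : nat := #|` fset_set A|%fset.

Definition space_complexity (X1 X2 U1 U2 : choiceType) (Y : Type)
    (S1 : system X1 U1 Y) (S2 : system X2 U2 Y) : nat :=
  let C := composition S1 S2 in
  \max_(k <- [:: ncard (trans S1); ncard (trans S2); ncard (trans C);
                 ncard (trans (Nb C))]) k.

(* Main.v *)
Require Import Defs.
From mathcomp Require Import all_boot all_order all_algebra finmap.
From mathcomp Require Import all_classical all_reals all_analysis.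
From mathcomp Require Import measurable_realfun zify lra.
Import Order.TTheory GRing.Theory Num.Theory.
Import numFieldNormedType.Exports.
Local Open Scope classical_set_scope.
Local Open Scope ring_scope.

Set Implicit Arguments.
Unset Strict Implicit.

(** The bound holds with constant 1, because symbolic systems are
    deterministic: a state and an input of [symbolic] have at most one
    successor ([symbolic_trans_deterministic]).  Hence the plant has at most
    one transition per pair (state, input), and the specification, whose only
    input is 0, at most one per state.  A state of the composition is a pair of
    points with the same output; as the output map is the inclusion, the two
    points coincide.  So a transition of the composition is determined by its
    plant component, the composition has no more transitions than the plant,
    and its non-blocking part, a sub-system, has no more either.

    Determinism has two ingredients.  The half-open boxes of radius [eta]
    around the points of the grid of step [2 * eta] are disjoint
    ([grid_box_unique]), and the point reached from a state under a constant
    input is unique ([reaches_unique]).  The latter is uniqueness of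
    Caratheodory solutions.  The difference [g] of two solutions is absolutely
    continuous, vanishes at 0, and satisfies [`|g'| <= L * `|g|] almost
    everywhere, where [L] is a Lipschitz constant of the field on the compact
    union of the two curves; a Gronwall argument then forces [g = 0]
    ([ac_gronwall_zero]).

    That argument rests on the mean value inequality for absolutely continuous
    curves with an almost everywhere bounded derivative ([ac_increment_le]).
    It is obtained without integrating the derivative, by covering [[c, d]]
    with finitely many short intervals of two sorts: near a point where the
    derivative exists, increments are controlled by the derivative; the
    remaining points form a null set, which has an open neighbourhood of small
    measure, so absolute continuity makes the sum of the increments over the
    intervals inside that neighbourhood small.  The finite cover comes from
    completeness of the reals ([interval_induction]). *)

(** * The mean value inequality for absolutely continuous curves *)

(** Compactness of [[c, d]] in the form of Cousin's lemma: [P] is a property of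
    sub-intervals, and chaining the local instances reaches past the supremum
    of the points [s] with [P c s]. *)
Lemma interval_induction (R : realType) (c d : R) (P : R -> R -> Prop) :
  c <= d ->
  (forall x y z, c <= x -> x <= y -> y <= z -> z <= d ->
    P x y -> P y z -> P x z) ->
  (forall t, c <= t <= d -> exists2 r, 0 < r &
    forall x y, c <= x -> x <= t -> t <= y -> y <= d ->
      t - r < x -> y < t + r -> P x y) ->
  P c d.
Proof.
move=> cd Ptrans Ploc.
pose S := [set s | c <= s <= d /\ P c s].
have Sc : S c.
  have [|r r0 Pr] := Ploc c; first by rewrite lexx.
  by split; [rewrite lexx|apply: Pr => //; lra].
have Sd : ubound S d by move=> s [/andP[]].
have supS : has_sup S by split; [exists c|exists d].
have cS : c <= sup S by exact: sup_upper_bound.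
have Sled : sup S <= d by apply: ge_sup => //; exists c.
have [|r r0 Pr] := Ploc (sup S); first by rewrite cS.
have [s Ss rs] := sup_adherent r0 supS.
have sS := sup_upper_bound supS Ss.
have [/andP[cs _] Pcs] := Ss.
pose y := Num.min d (sup S + r / 2).
have Sy : sup S <= y by rewrite le_min Sled/= lerDl; lra.
have yd : y <= d by rewrite ge_min lexx.
have yr : y < sup S + r by rewrite gt_min; apply/orP; right; lra.
have Pcy : P c y.
  apply: (Ptrans _ s) => //; first exact: le_trans Sy.
  exact: Pr.
have yS : y <= sup S.
  by apply: sup_upper_bound => //; split=> //; rewrite yd (le_trans cS).
have -> : d = y by move: yS yd; rewrite /y; case: (leP d); lra.
by [].
Qed.

(** The radius [r] depends on the point [t]: this is the gauge of the cover in
    the mean value inequality. *)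
Lemma derive_growth (R : realType) (V : normedModType R) (g : R -> V)
    (t M e : R) (l : V) : 0 < e -> `|l| <= M -> is_derive t (1 : R) g l ->
  exists2 r, 0 < r & forall s, `|s - t| < r ->
    `|g s - g t| <= (M + e) * `|s - t|.
Proof.
move=> e0 lM [dg dgl].
have /cvgr_dist_lt/(_ _ e0) :
    h^-1 *: ((g \o shift t) (h *: 1) - g t) @[h --> 0^'] --> l.
  by rewrite -dgl.
rewrite /dnbhs/= => /nbhs_ballP[r /= r0 hr].
exists r => // s str.
have [->|st] := eqVneq s t; first by rewrite !subrr !normr0 mulr0.
have st0 : s - t != 0 by rewrite subr_eq0.
have := hr (s - t).
rewrite /ball/= sub0r normrN => /(_ str st0).
rewrite -[_ *: 1]/(_ * 1) mulr1 subrK => h.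
have -> : g s - g t = (s - t) *: ((s - t)^-1 *: (g s - g t)).
  by rewrite scalerA divff// scale1r.
rewrite normrZ mulrC ler_wpM2r//.
rewrite -[X in `|X|](subrK l) addrC (le_trans (ler_normD _ _))// lerD//.
by rewrite distrC ltW.
Qed.

Lemma null_set_cover (R : realType) (E : set R) (e : R) :
  0 < e -> (@lebesgue_measure R).-negligible E ->
  exists W : set R, [/\ open W, E `<=` W & (lebesgue_measure W < e%:E)%E].
Proof.
move=> e0 [B [mB B0 EB]].
have [|W [oW BW We]] := lebesgue_regularity_outer mB _ e0.
  by rewrite [X in (X < _)%E]B0 ltry.
exists W; split=> //; first exact: subset_trans BW.
rewrite -(setDUK BW) measureU//; last 2 first.
- by apply: measurableD => //; exact: open_measurable.
- by rewrite setDIK.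
by rewrite [X in (X + _)%E]B0 add0e.
Qed.

(** The chained property [P a b] says that the increment over [[a, b]] is at
    most [(M + e) * (b - a)] plus the increments over a finite family of
    disjoint intervals inside the small open set [W].  Bounding the total length
    of the family by the measure of [W] within the half-open [`]a, b]] makes the
    property additive, and the case [a = c], [b = d] puts the family within
    reach of absolute continuity. *)
Lemma ac_increment_le (R : realType) (n : nat) (g : R -> 'rV[R]_n) (c d M : R) :
  0 <= M -> c <= d -> abs_continuous c d g ->
  {ae @lebesgue_measure R, forall t, t \in `[c, d]%classic ->
    exists2 l, `|l| <= M & is_derive t (1 : R) g l} ->
  `|g d - g c| <= M * (d - c).
Proof.
move=> M0 cd acg dg.
apply/ler_addgt0Pr => e' e'0.
pose e := e' / (d - c + 1).
have dc1 : 0 < d - c + 1 by lra.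
have e0 : 0 < e by rewrite divr_gt0.
(* [e] is used twice: per unit of length, and as bound for the exceptional
   increments; the summand 1 in its denominator pays for the second use. *)
have -> : e' = e * (d - c) + e.
  by rewrite -[X in _ + X]mulr1 -mulrDr divfK// gt_eqF.
have [dl dl0 acs] := acg e e0.
have [W [oW EW Wdl]] := null_set_cover dl0 dg.
have mW : measurable W by exact: open_measurable.
pose vol a b := lebesgue_measure (W `&` `]a, b]).
have volD x y z : x <= y -> y <= z -> vol x z = (vol x y + vol y z)%E.
  move=> xy yz; rewrite /vol -measureU//.
  - by rewrite -setIUr (@itv_bndbnd_setU _ _ _ (BRight y)).
  - exact: measurableI.
  - exact: measurableI.
  apply/seteqP; split=> // t [[_ /=]]; rewrite in_itv/= => /andP[_ ty].
  by move=> [_ /=]; rewrite in_itv/= ltNge ty.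
pose P a b := exists s : seq (R * R), [/\
  forall p, p \in s -> a <= p.1 /\ p.1 <= p.2 /\ p.2 <= b,
  pairwise (fun p q : R * R => (p.2 <= q.1) || (q.2 <= p.1)) s,
  ((\sum_(p <- s) (p.2 - p.1))%:E <= vol a b)%E &
  `|g b - g a| <= (M + e) * (b - a) + \sum_(p <- s) `|g p.2 - g p.1| ].
have [| |s [s_in s_disj s_vol s_inc]] := @interval_induction R c d P cd.
- move=> x y z cx xy yz zd [s1 [in1 pw1 v1 i1]] [s2 [in2 pw2 v2 i2]].
  exists (s1 ++ s2); split.
  + move=> p; rewrite mem_cat => /orP[/in1|/in2] [? []]; lra.
  + rewrite pairwise_cat pw1 pw2 !andbT; apply/allrelP => p q /in1 ? /in2 ?.
    by apply/orP; left; lra.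
  + by rewrite big_cat/= EFinD (volD x y z)// leeD.
  + rewrite big_cat/= -(subrKA (g y)) addrC (le_trans (ler_normD _ _))//.
    by lra.
- move=> t tcd.
  (* Points of [W] are put in the family even where [g] is differentiable;
     outside [W] the derivative exists by the choice of [W]. *)
  have [Wt|nWt] := pselect (W t).
    have /nbhs_ballP[r /= r0 rW] : nbhs t W by exact: open_nbhs_nbhs.
    exists r => // x y cx xt ty yd trx ytr; exists [:: (x, y)]; split=> //.
    + move=> p; rewrite inE => /eqP ->/=; lra.
    + rewrite big_seq1/= /vol setIidr.
        rewrite lebesgue_measure_itv/= lte_fin.
        by case: ltP => //; rewrite lee_fin; lra.
      move=> z /=; rewrite in_itv/= => /andP[xz zy]; apply: rW.
      by rewrite /ball/= ltr_norml; lra.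
    + rewrite big_seq1/= lerDr mulr_ge0//; last by lra.
      by rewrite addr_ge0 // ltW.
  have [l lM dl'] : exists2 l, `|l| <= M & is_derive t (1 : R) g l.
    apply: contrapT => H; apply/nWt/EW => /= /(_ _)K; apply/H/K.
    by rewrite inE/= in_itv.
  have [r r0 rg] := derive_growth e0 lM dl'.
  exists r => // x y cx xt ty yd trx ytr; exists [::]; split=> //.
    by rewrite big_nil measure_ge0.
  rewrite big_nil addr0 -(subrKA (g t)) addrC.
  rewrite (le_trans (ler_normD _ _))//.
  have := rg y; rewrite ger0_norm; last lra.
  have := rg x; rewrite distrC (distrC (g x)) ger0_norm; last lra.
  move=> /(_ ltac:(lra)) h1 /(_ ltac:(lra)) h2.
  lra.
rewrite (le_trans s_inc)// mulrDl -addrA lerD2l lerD2l ltW//.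
apply: acs => //.
rewrite -lte_fin (le_lt_trans s_vol)// (le_lt_trans _ Wdl)//.
by apply: le_measure; rewrite ?inE//; exact: measurableI.
Qed.

(** * Uniqueness of Caratheodory solutions *)

Lemma abs_continuous_subitv (R : realType) (n : nat) (g : R -> 'rV[R]_n)
    (c d c' d' : R) : c <= c' -> d' <= d ->
  abs_continuous c d g -> abs_continuous c' d' g.
Proof.
move=> cc' d'd acg e /acg[dl dl0 acs]; exists dl => // s s_in.
by apply: acs => p /s_in [? []]; lra.
Qed.

Lemma abs_continuousB (R : realType) (n : nat) (g h : R -> 'rV[R]_n) (c d : R) :
  abs_continuous c d g -> abs_continuous c d h ->
  abs_continuous c d (fun t => g t - h t).
Proof.
move=> acg ach e e0; have e20 : 0 < e / 2 by lra.
have [dg dg0 sg] := acg _ e20; have [dh dh0 sh] := ach _ e20.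
exists (Num.min dg dh); first by rewrite lt_min dg0.
move=> s s_in s_disj; rewrite lt_min => /andP[/(sg s s_in s_disj) gs].
move=> /(sh s s_in s_disj) hs; rewrite [ltRHS]splitr.
rewrite (le_lt_trans _ (ltrD gs hs))// -big_split/= ler_sum// => p _.
by rewrite opprD addrACA -opprD ler_normB.
Qed.

Lemma abs_continuous_within (R : realType) (n : nat) (g : R -> 'rV[R]_n)
    (c d : R) : abs_continuous c d g -> {within `[c, d], continuous g}.
Proof.
move=> acg; apply/subspace_continuousP => x /=; rewrite in_itv/= => xcd.
apply/cvgrPdist_lt => e /acg[dl dl0 acs].
rewrite near_withinE; apply/nbhs_ballP; exists dl => //= y.
rewrite /ball/= ltr_norml => yx; rewrite in_itv/= => ycd.
have [xy|yx'] := leP x y.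
  have := acs [:: (x, y)]; rewrite !big_seq1/= distrC; apply => //; last lra.
  by move=> p; rewrite inE => /eqP ->/=; lra.
have := acs [:: (y, x)]; rewrite !big_seq1/=; apply => //; last lra.
by move=> p; rewrite inE => /eqP ->/=; lra.
Qed.

(** On an interval of length at most [h] starting at a zero of [g], the mean
    value inequality bounds the maximum of [`|g|] by [L * h], at most one half,
    times itself, so [g] vanishes there.  Steps of length [h] then exhaust
    [[0, T]]. *)
Lemma ac_gronwall_zero (R : realType) (n : nat) (g : R -> 'rV[R]_n) (T L : R) :
  0 <= L -> abs_continuous 0 T g -> g 0 = 0 ->
  {ae @lebesgue_measure R, forall t, t \in `[0, T]%classic ->
    exists2 l, `|l| <= L * `|g t| & is_derive t (1 : R) g l} ->
  forall t, 0 <= t <= T -> g t = 0.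
Proof.
move=> L0 acg g0 dg.
pose h : R := (2 * (L + 1))^-1.
have h0 : 0 < h by rewrite invr_gt0; lra.
have Lh : L * h <= 2^-1.
  by rewrite ler_pdivrMr; lra.
suff step k : forall t, 0 <= t <= T -> t <= k%:R * h -> g t = 0.
  move=> t tT; apply: (step (Num.Def.archi_bound (t / h))) => //.
  rewrite -ler_pdivrMr// ltW// archi_boundP// divr_ge0//; lra.
elim: k => [|k IH] t tT.
  by rewrite mul0r => t0; have -> : t = 0 by lra.
have [tk _|kt] := leP t (k%:R * h); first exact: IH.
rewrite mulrSr mulrDl mul1r => tkh.
set a := k%:R * h in kt tkh IH.
have a0 : 0 <= a by rewrite mulr_ge0// ltW.
have ga : g a = 0 by apply: IH; lra.
have cg : {within `[a, t], continuous (fun x => `|g x|)}.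
  have /abs_continuous_within/subspace_continuousP cg : abs_continuous a t g.
    by apply: abs_continuous_subitv acg; lra.
  by apply/subspace_continuousP => x /cg; exact: cvg_norm.
have [s /[!in_itv]/= sat smax] := EVT_max (ltW kt) cg.
have gs : `|g s| <= L * `|g s| * (s - a).
  rewrite -[X in X <= _](_ : `|g s - g a| = _); last by rewrite ga subr0.
  apply: ac_increment_le.
  - by rewrite mulr_ge0.
  - lra.
  - by apply: abs_continuous_subitv acg; lra.
  have aeF := ae_filter_ringOfSetsType (@lebesgue_measure R).
  apply: filterS dg => x + xas.
  move: (xas); rewrite inE/= in_itv/= => xas'.
  case=> [|l lg dl]; first by rewrite inE/= in_itv/=; lra.
  by exists l => //; rewrite (le_trans lg)// ler_wpM2l// smax// in_itv/=; lra.
have := smax t; rewrite in_itv/= lexx ltW// => /(_ isT) gts.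
have : L * `|g s| * (s - a) <= `|g s| * 2^-1.
  rewrite (mulrC L) -mulrA ler_wpM2l// (le_trans _ Lh)// ler_wpM2l//; lra.
move=> gs2; apply/eqP; rewrite -normr_le0; lra.
Qed.

(** The field is Lipschitz on compact sets only; the one used here is the union
    of the two curves that join [x] to [z] and to [z']. *)
Lemma reaches_unique (R : realType) (n m : nat) (Sigma : control_system R n m)
    (x z z' : 'rV[R]_n) (u : 'rV[R]_m) (tau : R) :
  0 <= tau -> cs_input Sigma u ->
  reaches Sigma x u tau z -> reaches Sigma x u tau z' -> z = z'.
Proof.
move=> tau0 Uu [xi [[acx dx] x0 <-]] [xi' [[acx' dx'] x0' <-]].
have {}acx := acx 0 tau (@subset_refl _ _).
have {}acx' := acx' 0 tau (@subset_refl _ _).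
have cpt (f : R -> 'rV[R]_n) :
    abs_continuous 0 tau f -> compact (f @` `[0, tau]).
  move=> acf; apply: continuous_compact; last exact: segment_compact.
  exact: abs_continuous_within.
have [L lip] := cs_field_lipschitz Sigma (compactU (cpt _ acx) (cpt _ acx')).
apply/eqP; rewrite -subr_eq0; apply/eqP.
apply: (@ac_gronwall_zero _ _ (fun t => xi t - xi' t) tau `|L|) => //.
- exact: abs_continuousB.
- by rewrite x0 x0' subrr.
- have aeF := ae_filter_ringOfSetsType (@lebesgue_measure R).
  apply: filterS2 dx dx' => t dt dt' /set_mem ttau.
  have {}dt := dt ttau; have {}dt' := dt' ttau.
  exists (cs_field Sigma (xi t) u - cs_field Sigma (xi' t) u).
    apply: (@le_trans _ _ (L * `|xi t - xi' t|)).
      by apply: lip => //; [left|right]; exists t.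
    by rewrite ler_wpM2r// ler_norm.
  exact: is_deriveB.
- by rewrite lexx tau0.
Qed.

(** * Grids *)

(** If two boxes of radius [eta] share a point, the grid coordinates of their
    centres differ by less than one step; strictness comes from the boxes being
    half-open. *)
Lemma grid_box_unique (R : realType) (n : nat) (A : set 'rV[R]_n) (eta : R)
    (y y' z : 'rV[R]_n) : 0 < eta ->
  grid A (2 * eta) y -> grid A (2 * eta) y' -> box eta y z -> box eta y' z ->
  y = y'.
Proof.
move=> eta0 [_ gy] [_ gy'] yz y'z; apply/rowP => i.
have [k ek] := gy i; have [k' ek'] := gy' i.
have := yz i; have := y'z i; rewrite ek ek' => b b'.
have : (k - k')%:~R * (2 * eta) < 2 * eta by rewrite rmorphB/=; lra.
have : (k' - k)%:~R * (2 * eta) < 2 * eta by rewrite rmorphB/=; lra.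
have eta2 : 0 < 2 * eta by lra.
rewrite !gtr_pMl// -[1]/(1%:~R) !ltr_int => h1 h2.
by congr (_%:~R * _); lia.
Qed.

Lemma grid_finite (R : realType) (n : nat) (A : set 'rV[R]_n) (d : R) :
  0 < d -> bounded_set A -> finite_set (grid A d).
Proof.
move=> d0 [M0 [_ bA]].
pose M := `|M0| + 1.
have AM a : A a -> `|a| <= M.
  by apply: bA; rewrite /M; have := ler_norm M0; lra.
pose N := Num.Def.archi_bound (M / d).
have MN : M < N%:R * d.
  rewrite -ltr_pdivrMr// archi_boundP// divr_ge0 ?ltW// /M.
  by rewrite ltr_pwDr.
(* Shifting by [N] turns the coordinates, between [- N] and [N], into
   ordinals. *)
pose F (k : {ffun 'I_n -> 'I_(N + N).+1}) : 'rV[R]_n :=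
  \row_i (((k i)%:Z - N%:Z)%:~R * d).
apply: (@sub_finite_set _ _ (range F)).
  move=> a [Aa ga].
  have kP i : exists k : 'I_(N + N).+1, a 0 i = ((k : nat)%:Z - N%:Z)%:~R * d.
    have [k ak] := ga i.
    have : `|a 0 i| < N%:R * d.
      apply: le_lt_trans MN; apply: le_trans (AM a Aa).
      rewrite [leRHS]mx_normrE.
      exact: (le_bigmax _ (fun ij => `|a ij.1 ij.2|) (0, i)).
    rewrite ak normrM (gtr0_norm d0) ltr_pM2r// -intr_norm.
    rewrite -[N%:R]/(N%:Z%:~R) ltr_int => kN.
    have kN' : (`|(k + N%:Z)%R|%N < (N + N).+1)%N by lia.
    exists (Ordinal kN') => /=; congr (_%:~R * _); lia.
  have [k ak] := choice kP.
  by exists [ffun i => k i] => //; apply/rowP => i; rewrite !mxE ffunE -ak.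
by apply: finite_image; exact: finite_finset.
Qed.

Lemma grid0 (R : realType) (m : nat) (d : R) :
  grid [set 0 : 'rV[R]_m] d = [set 0].
Proof.
apply/seteqP; split=> [a []//|_ ->]; split=> // i.
by exists 0; rewrite mxE mul0r.
Qed.

(** * Counting transitions *)

Lemma ncard_inj_le (S T : choiceType) (f : S -> T) (A : set S) (B : set T) :
  finite_set B -> (forall x, A x -> B (f x)) -> {in A &, injective f} ->
  finite_set A /\ (ncard A <= ncard B)%N.
Proof.
move=> finB AB finj.
have AleB : (A #<= B)%card.
  rewrite -(card_le_eql (inj_card_eq finj)).
  by apply: subset_card_le => _ [x /AB Bx <-].
split; first exact: card_le_finite AleB finB.
apply: geq_card_fset_set; apply: card_le_trans AleB _.
have /finite_setP[k Bk] := finB.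
by rewrite /ncard (card_fset_set Bk) (card_le_eql Bk).
Qed.

Lemma ncardX (S T : choiceType) (A : set S) (B : set T) :
  finite_set A -> finite_set B -> ncard (A `*` B) = (ncard A * ncard B)%N.
Proof.
move=> finA finB; rewrite /ncard fset_setX//.
rewrite -(size_allpairs pair); apply/perm_size/uniq_perm => //.
  by apply: allpairs_uniq => // -[? ?] [? ?] _ _ /=.
move=> [x y]; rewrite in_fsetM/=; apply/andP/allpairsP => /=.
  by move=> [xA yB]; exists (x, y).
by move=> [[x' y'] [xA yB [-> ->]]].
Qed.

Lemma symbolic_trans_deterministic (R : realType) (n m : nat)
    (tau eta mu : R) (Sigma : control_system R n m)
    (x y y' : 'rV[R]_n) (u : 'rV[R]_m) :
  0 <= tau -> 0 < eta -> trans (symbolic tau eta mu Sigma) (x, u, y) ->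
  trans (symbolic tau eta mu Sigma) (x, u, y') -> y = y'.
Proof.
move=> tau0 eta0 [/= _ [Uu _] gy [z [xz yz _]]] [/= _ _ gy' [z' [xz' yz' _]]].
have zz' := reaches_unique tau0 Uu xz xz'; rewrite -zz' in yz'.
exact: grid_box_unique eta0 gy gy' yz yz'.
Qed.

Lemma symbolic_trans_count (R : realType) (n m : nat)
    (tau eta mu : R) (Sigma : control_system R n m) :
  0 <= tau -> 0 < eta -> finite_set (grid (cs_state Sigma) (2 * eta)) ->
  finite_set (grid (cs_input Sigma) (2 * mu)) ->
  finite_set (trans (symbolic tau eta mu Sigma)) /\
  (ncard (trans (symbolic tau eta mu Sigma)) <=
    ncard (grid (cs_state Sigma) (2 * eta)) *
    ncard (grid (cs_input Sigma) (2 * mu)))%N.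
Proof.
move=> tau0 eta0 finX finU; rewrite -ncardX//.
apply: (@ncard_inj_le _ _ fst); first exact: finite_setX.
  by move=> t [].
move=> [[x u] y] [[x' u'] y'] /set_mem t /set_mem t' /= [ex eu].
congr (_, _, _) => //.
by subst x' u'; exact: symbolic_trans_deterministic tau0 eta0 t t'.
Qed.

(** Equal outputs mean equal points and the second input is 0, so forgetting the
    second component of a transition loses nothing. *)
Lemma composition_trans_count (R : realType) (n mp mq : nat)
    (tau eta mu nu : R) (P : control_system R n mp)
    (Q : control_system R n mq) :
  let Sp := symbolic tau eta mu P in
  let C := composition Sp (symbolic tau eta nu Q) in
  cs_input Q = [set 0] -> finite_set (trans Sp) ->
  finite_set (trans C) /\ (ncard (trans C) <= ncard (trans Sp))%N.
Proof.
move=> Sp C Q0 finP.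
apply: (@ncard_inj_le _ _ (fun t => (t.1.1.1, t.1.2.1, t.2.1))) => //.
  by move=> t [].
move=> [[[x1 x2] [u1 u2]] [y1 y2]] [[[x1' x2'] [u1' u2']] [y1' y2']].
move=> /set_mem[[_ _ /= ex] [_ _ /= ey] _ [_ [u2Q _] _ _]].
move=> /set_mem[[_ _ /= ex'] [_ _ /= ey'] _ [_ [u2Q' _] _ _]].
move: u2Q u2Q'; rewrite /= Q0 => -> -> [ex1 eu1 ey1].
by subst.
Qed.

Lemma Nb_trans_count (X U : choiceType) (Y : Type) (S : system X U Y) :
  finite_set (trans S) ->
  finite_set (trans (Nb S)) /\ (ncard (trans (Nb S)) <= ncard (trans S))%N.
Proof.
move=> finS; have [[[_ _ _ NbS _] _] _ _] := NbP S.
by apply: (@ncard_inj_le _ _ id) => // x y _ _.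
Qed.

Theorem proposition6p1 : exists C : nat,
  forall (R : realType) (n mp mq : nat)
    (P : control_system R n mp) (Q : control_system R n mq)
    (beta_p beta_q : R -> R -> R) (gamma_p : R -> R)
    (eps theta_p theta_q tau eta mu : R),
  autonomous Q ->
  bounded_set (cs_state P) -> bounded_set (cs_input P) ->
  bounded_set (cs_state Q) ->
  delta_ISS P beta_p gamma_p ->
  (exists gamma_q : R -> R, delta_ISS Q beta_q gamma_q) ->
  0 < eps -> 0 < theta_p -> 0 < theta_q -> 0 < tau -> 0 < eta -> 0 < mu ->
  theta_p + theta_q <= eps ->
  beta_p theta_p tau + gamma_p mu + eta <= theta_p ->
  beta_q theta_q tau + eta <= theta_q ->
  let Sp := symbolic tau eta mu P in
  let Sq := symbolic tau eta 0 Q in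
  let Cstar := composition Sp Sq in
  [/\ finite_set (trans Sp), finite_set (trans Sq),
      finite_set (trans Cstar), finite_set (trans (Nb Cstar))
    & (space_complexity Sp Sq <=
        C * maxn (ncard (grid (cs_state P) (2 * eta)) *
                  ncard (grid (cs_input P) (2 * mu)))
                 (ncard (grid (cs_state Q) (2 * eta))))%N].
Proof.
exists 1%N => R n mp mq P Q beta_p beta_q gamma_p.
move=> eps theta_p theta_q tau eta mu.
move=> [Q0 _] bXp bUp bXq _ _ _ _ _ tau0 eta0 mu0 _ _ _ Sp Sq Cstar.
have eta20 : 0 < 2 * eta by rewrite mulr_gt0.
have mu20 : 0 < 2 * mu by rewrite mulr_gt0.
have finUq : finite_set (grid (cs_input Q) (2 * 0)).
  by rewrite Q0 grid0; exact: finite_set1.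
have [finSp leSp] : finite_set (trans Sp) /\ _ :=
  symbolic_trans_count (ltW tau0) eta0 (grid_finite eta20 bXp)
    (grid_finite mu20 bUp).
have [finSq leSq] : finite_set (trans Sq) /\ _ :=
  symbolic_trans_count (ltW tau0) eta0 (grid_finite eta20 bXq) finUq.
rewrite Q0 grid0 {3}/ncard fset_set1 cardfs1 muln1 in leSq.
have [finC leC] : finite_set (trans Cstar) /\ _ :=
  composition_trans_count 0 Q0 finSp.
have [finN leN] := Nb_trans_count finC.
split=> //.
have leCp := leq_trans leC leSp; have leNp := leq_trans leN leCp.
rewrite mul1n /space_complexity !big_cons big_nil !geq_max !leq_max.
by rewrite leSp leSq leCp leNp orbT.
Qed.
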